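(* Let $K$ be a field and let $a,b,c,d\in K$ satisfy $a^2+b^2+c^2+d^2=-1$. Let $K[x,y,z]=K[X,Y,Z]/(X^2+Y^2+Z^2-1)$, where $x,y,z$ denote the images of the polynomial variables $X,Y,Z$. Define the following elements of $K[x,y,z]$: \begin{align*} m_1 &= (-2abc + a^{2} - b^{2})\, y + (a^{2}c - b^{2}c + 2ab)\, z,\\ m_2 &= (abc - a^{2} + c^{2} + 1)\, x + (bc^{2} + ac + 2b)\, y + (-ac^{2} + bc - 2a)\, z - acd,\\ m_3 &= (-a^{2}c + c^{3} - ab + c)\, x + (2ac^{2} + bc + a)\, y + (2bc^{2} - ac + b)\, z + ad,\\ m_4 &= (-a^{2}bd - b^{3}d)\, z + 2a^{2}bc - a^{3} + ab^{2},\\ m_5 &= (ab^{2}d + bcd - ad)\, x + (b^{2}cd - 2abd)\, y + (-abcd + a^{2}d + b^{2}d)\, z - a^{3}b + ab^{3} + abc^{2} - a^{2}c,\\ m_6 &= (a^{2}bd + bc^{2}d - acd)\, x + (-a^{2}d)\, y + (2b^{2}cd - abd)\, z + 2a^{2}b^{2} - abc + a^{2}, \end{align*} and set \[ M=\begin{pmatrix} x & y & z\\ m_1 & m_2 & m_3\\ m_4 & m_5 & m_6\end{pmatrix}. \] Then, in $K[x,y,z]$, \[ \det(M)=2a^2(a^2+d^2)(a^2-b^2-2abc). \]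
   Context: Elements of $K$ are regarded as elements of $K[x,y,z]=K[X,Y,Z]/(X^2+Y^2+Z^2-1)$, the coordinate ring of the algebraic unit sphere over $K$, via the natural map. *)

(* Defs.v *)
From HB Require Import structures.
From mathcomp Require Import all_boot all_order all_algebra.
From mathcomp Require Import ring_quotient boolp mpoly.

Set Implicit Arguments.
Unset Strict Implicit.
Unset Printing Implicit Defensive.

Import GRing.Theory.
Local Open Scope ring_scope.
Local Open Scope quotient_scope.

Section SphereRing.
Variable K : fieldType.

(* The indices are in the cyclic ring on 'I_3, so that 'X_0, 'X_1, 'X_2 are the
   three variables X, Y, Z. *)
Definition sphere_poly : {mpoly K[3]} :=
  'X_0 ^+ 2 + 'X_1 ^+ 2 + 'X_2 ^+ 2 - 1.

Definition sphere_ideal : {pred {mpoly K[3]}} :=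
  fun p => `[< exists q, p = q * sphere_poly >].

Lemma sphere_idealP p :
  reflect (exists q, p = q * sphere_poly) (p \in sphere_ideal).
Proof. exact: asboolP. Qed.

(* The ideal is proper because sphere_poly vanishes at (1, 0, 0). *)
Lemma sphere_ideal_closed : idealr_closed sphere_ideal.
Proof.
split.
- by apply/sphere_idealP; exists 0; rewrite mul0r.
- apply/sphere_idealP => -[q /(congr1 (meval (fun i => (i == 0)%:R)))].
  rewrite /sphere_poly !(mevalM, mevalB, mevalD, expr2, mevalXU, meval1) /=.
  by rewrite mulr1 mulr0 !addr0 subrr mulr0 => /eqP; rewrite oner_eq0.
- move=> u p1 p2 /sphere_idealP[q1 ->] /sphere_idealP[q2 ->].
  by apply/sphere_idealP; exists (u * q1 + q2); rewrite mulrDl mulrA.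
Qed.

HB.instance Definition _ :=
  isIdealr.Build {mpoly K[3]} sphere_ideal sphere_ideal_closed.

Definition sphere_ring := {ideal_quot sphere_ideal}.

HB.instance Definition _ := GRing.ComNzRing.on sphere_ring.

Definition sphere_proj : {mpoly K[3]} -> sphere_ring := \pi_{ideal_quot sphere_ideal}.

HB.instance Definition _ := GRing.RMorphism.on sphere_proj.

Definition sphere_const : K -> sphere_ring := sphere_proj \o @mpolyC 3 K.

HB.instance Definition _ := GRing.RMorphism.on sphere_const.

Definition sphere_x : sphere_ring := sphere_proj 'X_0.
Definition sphere_y : sphere_ring := sphere_proj 'X_1.
Definition sphere_z : sphere_ring := sphere_proj 'X_2.

End SphereRing.

Definition mx33 (R : comNzRingType) (s : seq (seq R)) : 'M[R]_3 :=
  \matrix_(i < 3, j < 3) nth 0 (nth [::] s i) j.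

Notation "c %:S" := (sphere_const c) (at level 2, left associativity, format "c %:S") : ring_scope.

(* Main.v *)
Require Import Defs.
From HB Require Import structures.
From mathcomp Require Import all_boot all_order all_algebra.
From mathcomp Require Import ring_quotient mpoly ring.
Import GRing.Theory.
Local Open Scope ring_scope.

(** The statement is a polynomial identity modulo two relations: the sphere equation
    [x^2 = 1 - y^2 - z^2] and the hypothesis on the constants, solved for [d^2]. Expanding the
    determinant ([det_mx33]) and eliminating [x^2] (by [sphere_eq]) and [d^2] makes every term in
    [x], [y], [z] cancel, which leaves the stated constant. *)

Lemma det_mx33 (R : comNzRingType) (a11 a12 a13 a21 a22 a23 a31 a32 a33 : R) :
  \det (mx33 [:: [:: a11; a12; a13]; [:: a21; a22; a23]; [:: a31; a32; a33]]) =
  a11 * (a22 * a33 - a23 * a32) - a12 * (a21 * a33 - a23 * a31)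
  + a13 * (a21 * a32 - a22 * a31).
Proof.
do 2 rewrite !(expand_det_row _ ord0) !big_ord_recl !big_ord0 /cofactor.
rewrite !det_mx11 !mxE /= /bump /=; ring.
Qed.

Lemma sphere_eq (K : fieldType) :
  sphere_x K ^+ 2 = 1 - sphere_y K ^+ 2 - sphere_z K ^+ 2.
Proof.
have : sphere_proj (sphere_poly K) = 0.
  (* Two classes are equal exactly when their difference lies in the ideal; the generator does, with
     cofactor 1. *)
  apply/eqP; rewrite -(rmorph0 (@sphere_proj K)) -[_ == _]Quotient.idealrBE subr0.
  by apply/sphere_idealP; exists 1; rewrite mul1r.
rewrite /sphere_poly rmorphB !rmorphD !rmorphXn rmorph1 /= => /eqP.
rewrite subr_eq0 => /eqP <-; rewrite /sphere_x /sphere_y /sphere_z; ring.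
Qed.

Theorem theorem1p2 (K : fieldType) (a b c d : K)
    (habcd : a ^+ 2 + b ^+ 2 + c ^+ 2 + d ^+ 2 = -1) :
  let x := sphere_x K in
  let y := sphere_y K in
  let z := sphere_z K in
  let m1 :=
    (- 2 * a * b * c + a ^+ 2 - b ^+ 2)%:S * y
    + (a ^+ 2 * c - b ^+ 2 * c + 2 * a * b)%:S * z in
  let m2 :=
    (a * b * c - a ^+ 2 + c ^+ 2 + 1)%:S * x
    + (b * c ^+ 2 + a * c + 2 * b)%:S * y
    + (- a * c ^+ 2 + b * c - 2 * a)%:S * z
    - (a * c * d)%:S in
  let m3 :=
    (- a ^+ 2 * c + c ^+ 3 - a * b + c)%:S * x
    + (2 * a * c ^+ 2 + b * c + a)%:S * y
    + (2 * b * c ^+ 2 - a * c + b)%:S * z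
    + (a * d)%:S in
  let m4 :=
    (- a ^+ 2 * b * d - b ^+ 3 * d)%:S * z
    + (2 * a ^+ 2 * b * c - a ^+ 3 + a * b ^+ 2)%:S in
  let m5 :=
    (a * b ^+ 2 * d + b * c * d - a * d)%:S * x
    + (b ^+ 2 * c * d - 2 * a * b * d)%:S * y
    + (- a * b * c * d + a ^+ 2 * d + b ^+ 2 * d)%:S * z
    + (- a ^+ 3 * b + a * b ^+ 3 + a * b * c ^+ 2 - a ^+ 2 * c)%:S in
  let m6 :=
    (a ^+ 2 * b * d + b * c ^+ 2 * d - a * c * d)%:S * x
    + (- a ^+ 2 * d)%:S * y
    + (2 * b ^+ 2 * c * d - a * b * d)%:S * z
    + (2 * a ^+ 2 * b ^+ 2 - a * b * c + a ^+ 2)%:S in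
  let M := mx33 [:: [:: x ; y ; z];
                    [:: m1; m2; m3];
                    [:: m4; m5; m6]] in
  \det M =
    (2 * a ^+ 2 * (a ^+ 2 + d ^+ 2) * (a ^+ 2 - b ^+ 2 - 2 * a * b * c))%:S.
Proof.
move=> x y z m1 m2 m3 m4 m5 m6 /=.
have xE : x ^+ 2 = 1 - y ^+ 2 - z ^+ 2 := sphere_eq K.
have dE : d%:S ^+ 2 = - 1 - a%:S ^+ 2 - b%:S ^+ 2 - c%:S ^+ 2.
  (* Writing [-1] as the image of a constant lets the hypothesis on [K] be transported along
     [sphere_const]. *)
  rewrite -(rmorphN1 (@sphere_const K)) -habcd !rmorphD !rmorphXn; ring.
rewrite det_mx33 /m1 /m2 /m3 /m4 /m5 /m6.
rewrite !(rmorphB, rmorphD, rmorphN, rmorphM, rmorphXn, rmorph1, rmorph_nat) /=.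
(* From here on the seven ring elements are arbitrary, subject only to [xE] and [dE]; what they
   stand for is forgotten. *)
move: x y z xE a%:S b%:S c%:S d%:S dE {m1 m2 m3 m4 m5 m6} => x y z xE A B C D dE.
(* The relations xE and dE form a Groebner basis (coprime leading terms x^2 and
   d^2), so rewriting with them decides the congruence. *)
ring: xE dE.
Qed.
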